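(* Let $p$ be a prime number and assume $D=p^e$ is a prime power ($e\geq 1$). Then $R_{k,2,d}$ is irreducible over $\mathbb{Q}$ for all $k\geq 2$ and for all $d\geq 2$ that divide $D$.
   Context: Let $D\geq 2$ be an integer and, for $a\in\mathbb{C}$, let $f_a(z)=az^D+1$, with critical point $0$. A point $z$ is periodic for $f_a$ with period $n\geq 1$ if $f_a^{\circ n}(z)=z$ and $n$ is the least such integer; it is preperiodic with preperiod $k\geq 0$ and period $n$ if $k$ is the least nonnegative integer such that $f_a^{\circ k}(z)$ is periodic, and $f_a^{\circ k}(z)$ has period $n$. For $n\geq 1$, $P_n\in\mathbb{Z}[a]$ is defined by $P_n(a)=f_a^{\circ n}(0)$, i.e. $P_1=1$ and $P_{n+1}=aP_n^D+1$. For $k\geq 2$, $n\geq 1$ and $d\geq 2$ dividing $D$, $R_{k,n,d}$ is the monic polynomial with simple roots whose roots are the parameters $a\in\mathbb{C}$ such that $0$ is preperiodic for $f_a$ with preperiod $k$ and period $n$, and $f_a^{\circ(k+n-1)}(0)=\omega f_a^{\circ(k-1)}(0)$ for some primitive $d$-th root of unity $\omega$. It belongs to $\mathbb{Z}[a]$; equivalently, $R_{k,n,d}=\prod_{m\mid n}\left(P_{k,m,d}/P_{\gcd(m,k-1)}^{\varphi(d)}\right)^{\mu(n/m)}$, where $P_{k,m,d}:=\prod_{\omega}(P_{k+m-1}-\omega P_{k-1})$ (product over primitive $d$-th roots of unity), $\mu$ is the Möbius function and $\varphi$ is the Euler totient function. *)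

(* Defs.v *)
From mathcomp Require Import all_boot all_order all_algebra.
From mathcomp Require Import all_classical all_reals.
From mathcomp.real_closed Require Export complex.

Set Implicit Arguments.
Unset Strict Implicit.
Unset Printing Implicit Defensive.

Import GRing.Theory.
Local Open Scope ring_scope.
Local Open Scope classical_set_scope.

Definition unicritical (K : fieldType) (D : nat) (a z : K) : K :=
  a * z ^+ D + 1.

Section Dynamics.
Variables (T : Type) (f : T -> T).

Definition periodic_with_period (n : nat) (z : T) : Prop :=
  [/\ (0 < n)%N, iter n f z = z
    & forall m : nat, (0 < m)%N -> iter m f z = z -> (n <= m)%N].

Definition periodic (z : T) : Prop := exists n, periodic_with_period n z.

Definition preperiodic_with (k n : nat) (z : T) : Prop :=
  [/\ periodic_with_period n (iter k f z)
    & forall j : nat, periodic (iter j f z) -> (k <= j)%N].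

End Dynamics.

Definition misiurewicz_parameters (K : fieldType) (D k n d : nat) : set K :=
  [set a : K | preperiodic_with (unicritical D a) k n 0 /\
     exists2 w : K, d.-primitive_root w &
       iter (k + n - 1)%N (unicritical D a) 0 =
       w * iter (k - 1)%N (unicritical D a) 0].
Arguments misiurewicz_parameters : clear implicits.

(* The monic polynomial with simple roots exactly at the parameters above.
   Over C with D >= 2 this parameter set is finite: the parameters are roots
   of the nonzero polynomial f_a^(k + n)(0) - f_a^k(0) in a. (On an infinite
   set the finitely supported product would be 1.) *)
Definition misiurewicz_poly (K : fieldType) (D k n d : nat) : {poly K} :=
  \big[*%R/1]_(a \in misiurewicz_parameters K D k n d) ('X - a%:P).
Arguments misiurewicz_poly : clear implicits.

(* q has rational coefficients, and is irreducible as an element of Q[X]. *)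
Definition irreducible_over_rat (K : fieldType) (q : {poly K}) : Prop :=
  exists2 r : {poly rat}, map_poly ratr r = q & irreducible_poly r.

(* Main.v *)
Require Import Defs.
From mathcomp Require Import all_boot all_order all_algebra.
From mathcomp Require Import all_classical all_reals.
From mathcomp Require Import separable qpoly.
From mathcomp.real_closed Require polyorder.
From mathcomp Require Import zify ring.

(** Write P_n(a) for the n-th point of the orbit of 0, d = p^(j+1), q = p^j, and
let H(x, y) = (x^d - y^d) / (x^q - y^q) be the homogenized d-th cyclotomic
polynomial, the product of the x - w y over the primitive d-th roots of unity w.
The Misiurewicz parameters in question satisfy
B(a) := H(P_(k+1), P_(k-1)) = 0.  The spurious roots of B come from two sources:
those of A := H(P_k, P_(k-1)), where the period is 1, and a = -1, where 0 itself
has period 2.  Since d divides D, A divides B in Z[a], and for odd k so does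
the full power of a + 1 contributed by the homogeneity of H.  Dividing out gives
a monic Q in Z[a] with B = A (a + 1)^r Q (orbit_factorization).

The polynomial Q is Eisenstein at a = -1.  Indeed D is a power of p, so modulo p
the map z |-> z^D is additive, and the differences of consecutive and of
second-next orbit points differ by a factor (a + 1)^(D^n)
(crit_orbit_sub_pchar), while H(x, y) becomes a power of x - y; hence Q is a
power of a + 1 modulo p.  At a = -1 the orbit is 0, 1, 0, 1, ..., so that
A(-1) = 1 and Q(-1) = H(1, 1) = p, which is not divisible by p^2.

Irreducibility then pays for everything else.  Q has simple roots, being
irreducible in characteristic 0.  No root of Q is a root of A: otherwise Q would divide A
in Z[a], so p = Q(-1) would divide A(-1) = 1.  And -1 is not a root since
Q(-1) = p.  Therefore the roots of Q are exactly the parameters with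
B(a) = 0, A(a) <> 0 and a <> -1, which are the Misiurewicz parameters
(misiurewicz_parametersE), and Q is the polynomial of the theorem. *)

Set Implicit Arguments.
Unset Strict Implicit.
Unset Printing Implicit Defensive.

Import GRing.Theory Num.Theory Order.TTheory.
Local Open Scope ring_scope.
Local Open Scope complex_scope.

(** * The critical orbit and the homogenized cyclotomic polynomial *)

(** The parameter c lives in an arbitrary ring, so that one definition
serves for the polynomials P_n (with c the indeterminate), for their
reductions modulo p, and for their values. *)
Fixpoint crit_orbit (S : comNzRingType) (D : nat) (c : S) (n : nat) : S :=
  if n is n'.+1 then c * crit_orbit D c n' ^+ D + 1 else 0.

(** For p prime and q = p ^ j, this is the p^(j+1)-th cyclotomic polynomial made
homogeneous in x and y; see homog_cyclo_factor. *)
Definition homog_cyclo (S : comNzRingType) (p q : nat) (x y : S) : S :=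
  \sum_(i < p) (x ^+ q) ^+ (p.-1 - i) * (y ^+ q) ^+ i.

Lemma rmorph_crit_orbit (S T : comNzRingType) (g : {rmorphism S -> T}) D c n :
  g (crit_orbit D c n) = crit_orbit D (g c) n.
Proof.
elim: n => [|n IHn] /=; first by rewrite rmorph0.
by rewrite rmorphD rmorphM rmorphXn rmorph1 IHn.
Qed.

Lemma rmorph_homog_cyclo (S T : comNzRingType) (g : {rmorphism S -> T}) p q x y :
  g (homog_cyclo p q x y) = homog_cyclo p q (g x) (g y).
Proof. by rewrite rmorph_sum; apply: eq_bigr => i _; rewrite rmorphM !rmorphXn. Qed.

Section CommutativeRing.
Variable S : comNzRingType.
Implicit Types x y z c g : S.

Lemma homog_cyclo_factor p q x y :
  x ^+ (q * p) - y ^+ (q * p) = (x ^+ q - y ^+ q) * homog_cyclo p q x y.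
Proof. by rewrite !exprM subrXX. Qed.

Lemma homog_cyclo_homogeneous p q g x y :
  homog_cyclo p q (g * x) (g * y) = (g ^+ q) ^+ p.-1 * homog_cyclo p q x y.
Proof.
rewrite /homog_cyclo big_distrr /=; apply: eq_bigr => i _.
rewrite !exprMn mulrACA -exprD subnK //; have := ltn_ord i; lia.
Qed.

Lemma homog_cyclo11 p q : homog_cyclo p q 1 1 = p%:R :> S.
Proof.
rewrite /homog_cyclo (eq_bigr (fun=> 1)) => [|i _]; last by rewrite !expr1n mulr1.
by rewrite sumr_const card_ord.
Qed.

Lemma homog_cyclo01 p q : (0 < p)%N -> (0 < q)%N -> homog_cyclo p q 0 1 = 1 :> S.
Proof.
case: p => // p _ q0.
rewrite /homog_cyclo big_ord_recr /= subnn !expr1n expr0 mulr1 big1 ?add0r // => i _.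
by rewrite expr0n eqn0Ngt q0 expr0n /= subn_eq0 leqNgt ltn_ord /= mul0r.
Qed.

Lemma homog_cyclo10 p q : (0 < p)%N -> (0 < q)%N -> homog_cyclo p q 1 0 = 1 :> S.
Proof.
case: p => // p _ q0.
rewrite /homog_cyclo big_ord_recl /= !expr1n expr0 mulr1 big1 ?addr0 // => i _.
by rewrite [in 0 ^+ q]expr0n eqn0Ngt q0 expr0n /= mulr0.
Qed.

Lemma dvd_homog_cyclo_sub p q x y z :
  exists h, homog_cyclo p q x z - homog_cyclo p q y z = (x - y) * h.
Proof.
have subX n : exists h, x ^+ n - y ^+ n = (x - y) * h by rewrite subrXX; eexists.
rewrite /homog_cyclo -sumrB.
apply: (big_ind (fun s => exists h, s = (x - y) * h)) => [|a b [h ->] [h' ->]|i _].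
- by exists 0; rewrite mulr0.
- by exists (h + h'); rewrite mulrDr.
- rewrite -mulrBl -!exprM; have [h ->] := subX (q * (p.-1 - i))%N.
  by exists (h * z ^+ (q * i)); rewrite mulrA.
Qed.

(** A fixed point is in particular fixed by the second iterate.  The two values
of homog_cyclo are congruent modulo the difference of their first arguments,
which is c (x^D - y^D), and homog_cyclo p q x y divides x^D - y^D because
q p divides D. *)
Lemma homog_cyclo_orbit_dvd p q D c n : (q * p %| D)%N ->
  exists h, homog_cyclo p q (crit_orbit D c n.+2) (crit_orbit D c n) =
            homog_cyclo p q (crit_orbit D c n.+1) (crit_orbit D c n) * h.
Proof.
case/dvdnP => s Ds; set x := crit_orbit D c n.+1; set y := crit_orbit D c n.
have subX : exists h, x ^+ D - y ^+ D = homog_cyclo p q x y * h.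
  rewrite Ds mulnC [x ^+ _]exprM [y ^+ _]exprM subrXX homog_cyclo_factor.
  by rewrite -mulrA mulrCA; eexists.
have [h eh] := dvd_homog_cyclo_sub p q (crit_orbit D c n.+2) x y.
have [h' eh'] := subX.
exists (1 + c * h' * h); rewrite mulrDr mulr1.
apply/eqP; rewrite -subr_eq0 opprD addrA eh.
have ->: crit_orbit D c n.+2 - x = c * (x ^+ D - y ^+ D) by rewrite /x /y /=; ring.
by rewrite eh' subr_eq0; apply/eqP; ring.
Qed.

(** The even terms of positive index vanish to first order at c = -1, where 0
has period 2: two steps of the map send any multiple of c + 1 to c + 1 up to
second order, since D is at least 2. *)
Lemma crit_orbit_even D c n : (1 < D)%N ->
  exists h, crit_orbit D c n.*2.+2 = (c + 1) * (1 + (c + 1) * h).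
Proof.
case: D => [|[|D]] // _.
have step z h : z = (c + 1) * h ->
  exists h', c * (c * z ^+ D.+2 + 1) ^+ D.+2 + 1 = (c + 1) * (1 + (c + 1) * h').
  move=> ->; have := subrX1 (c * ((c + 1) * h) ^+ D.+2 + 1) D.+2.
  rewrite addrK => /eqP; rewrite subr_eq => /eqP ->.
  rewrite exprMn 2!exprS; set T := \sum_(i < _) _.
  by exists (c * c * (c + 1) ^+ D * h ^+ D.+2 * T); ring.
elim: n => [|n [h IHn]]; first by apply: (step 0 0); rewrite mulr0.
exact: (step _ _ IHn).
Qed.

Lemma crit_orbitN1 D n : (0 < D)%N -> crit_orbit D (-1) n = (odd n)%:R :> S.
Proof.
move=> D0; elim: n => //= n ->; case: (odd n) => /=; first by rewrite expr1n; ring.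
by rewrite expr0n eqn0Ngt D0 mulr0 add0r.
Qed.

End CommutativeRing.

(** * Monic polynomials *)

Section MonicPolynomials.
Variable S : idomainType.
Implicit Types x y : {poly S}.

Lemma crit_orbit_monic D n : (0 < D)%N ->
  crit_orbit D ('X : {poly S}) n.+1 \is monic /\
  (size (crit_orbit D ('X : {poly S}) n) < size (crit_orbit D ('X : {poly S}) n.+1))%N.
Proof.
move=> D0; elim: n => [|n [mon lts]].
  by rewrite /= expr0n eqn0Ngt D0 mulr0 add0r monic1 size_poly0 size_poly1.
rewrite [crit_orbit _ _ n.+2]/= -/(crit_orbit D 'X n.+1).
move: (crit_orbit D 'X n.+1) mon lts => x mon lts.
have s0 : (0 < size x)%N by apply: leq_ltn_trans lts.
have monX : 'X * x ^+ D \is monic by rewrite monicMl ?monicX // monic_exp.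
have sX : size ('X * x ^+ D) = ((size x).-1 * D).+2.
  rewrite mulrC size_mulX ?monic_neq0 ?monic_exp // -size_exp prednK //.
  by rewrite size_poly_gt0 monic_neq0 ?monic_exp.
split; last by rewrite size_polyDl sX ?size_poly1 //; nia.
by rewrite monicE lead_coefDl ?sX ?size_poly1 // -monicE.
Qed.

Lemma size_crit_orbit_mono D : (0 < D)%N ->
  {homo (fun n => size (crit_orbit D ('X : {poly S}) n)) : m n / (m < n)%N}.
Proof.
move=> D0; apply: homo_ltn; first exact: ltn_trans.
by move=> n; case: (crit_orbit_monic n D0).
Qed.

Lemma monic_subX x y n : (0 < n)%N -> x \is monic -> (size y < size x)%N ->
  x ^+ n - y ^+ n \is monic.
Proof.
move=> n0 mon lts; have s : (size (- y ^+ n)%R < size (x ^+ n)%R)%N.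
  have x0 : (0 < size x)%N by apply: leq_ltn_trans lts.
  have -> : size (x ^+ n) = ((size x).-1 * n).+1.
    by rewrite -size_exp prednK // size_poly_gt0 monic_neq0 ?monic_exp.
  rewrite size_polyN; have [->|y0] := eqVneq y 0.
    by rewrite expr0n eqn0Ngt n0 size_poly0.
  apply: leq_ltn_trans (size_poly_exp_leq _ _) _; move: y0.
  rewrite -size_poly_gt0 ltnS ltn_mul2r n0 /=.
  by move: lts; move: (size y) (size x) => a b; lia.
by rewrite monicE lead_coefDl // -monicE monic_exp.
Qed.

(** A quotient of monic polynomials is monic. *)
Lemma monic_homog_cyclo p q x y : (0 < p)%N -> (0 < q)%N ->
  x \is monic -> (size y < size x)%N -> homog_cyclo p q x y \is monic.
Proof.
move=> p0 q0 mon lts; have qp0 : (0 < q * p)%N by rewrite muln_gt0 q0.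
by have := monic_subX qp0 mon lts; rewrite homog_cyclo_factor monicMl ?monic_subX.
Qed.

Lemma cancel_XsubC_exp (c : S) n (u v w : {poly S}) : u.[c] != 0 ->
  u * v = ('X - c%:P) ^+ n * w -> exists2 v', v = ('X - c%:P) ^+ n * v' & u * v' = w.
Proof.
move=> uc0; elim: n w => [|n IHn] w.
  by rewrite expr0 mul1r => <-; exists v; rewrite ?mul1r.
rewrite exprSr -mulrA => /IHn [v' -> e].
have /factor_theorem [v'' Ev] : root v' c.
  have /eqP := congr1 (horner^~ c) e.
  by rewrite !hornerM !hornerE subrr mul0r mulf_eq0 (negbTE uc0).
exists v''; first by rewrite Ev -mulrA [v'' * _]mulrC.
apply: (mulfI (negbT (polyXsubC_eq0 c))).
by rewrite -e Ev; ring.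
Qed.

End MonicPolynomials.

(** * Reduction modulo p *)

Section ReductionModP.
Variable (p : nat) (S : idomainType).
Hypothesis pcharS : p \in [pchar S].
Implicit Types x y c : S.

Lemma expr_sub_pchar x y n : (x - y) ^+ (p ^ n) = x ^+ (p ^ n) - y ^+ (p ^ n).
Proof.
have pnatp : [pchar S].-nat (p ^ n)%N.
  by rewrite (eq_pnat _ (pcharf_eq pcharS)) pnatX pnat_id ?(pcharf_prime pcharS).
by apply/eqP; rewrite eq_sym subr_eq -(exprDn_pchar _ _ pnatp) subrK.
Qed.

(** In characteristic p, both x^(p^(j+1)) - y^(p^(j+1)) and x^(p^j) - y^(p^j) are
powers of x - y, hence so is their quotient. *)
Lemma homog_cyclo_pchar x y j :
  x != y -> homog_cyclo p (p ^ j) x y = (x - y) ^+ (p ^ j * p.-1).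
Proof.
move=> nxy; have xy0 : (x - y) ^+ (p ^ j) != 0 by rewrite expf_neq0 // subr_eq0.
apply: (mulfI xy0); rewrite {1}expr_sub_pchar.
rewrite -homog_cyclo_factor -expnSr -expr_sub_pchar -exprD.
by rewrite -mulnS prednK ?expnSr ?prime_gt0 ?(pcharf_prime pcharS).
Qed.

(** Both sequences of differences obey the recursion w |-> c w^D, because
z |-> z^D is additive; they start at c + 1 and at 1. *)
Lemma crit_orbit_sub_pchar e c n : let D := (p ^ e)%N in
  crit_orbit D c n.+2 - crit_orbit D c n =
  (crit_orbit D c n.+1 - crit_orbit D c n) * (c + 1) ^+ (D ^ n).
Proof.
move=> D; have D0 : (0 < D)%N by rewrite expn_gt0 prime_gt0 ?(pcharf_prime pcharS).
elim: n => [|n IHn].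
  rewrite /= expr0n eqn0Ngt D0 /= mulr0 add0r expr1n; ring.
have step u v : (c * u ^+ D + 1) - (c * v ^+ D + 1) = c * (u - v) ^+ D.
  by rewrite expr_sub_pchar; ring.
by rewrite [LHS]step IHn [X in _ = X * _]step exprMn -exprM -expnSr mulrA.
Qed.

Lemma crit_orbit_sub_neq0 e c n : c != 0 ->
  crit_orbit (p ^ e) c n.+1 - crit_orbit (p ^ e) c n != 0.
Proof.
move=> c0; set D := (p ^ e)%N.
have D0 : (0 < D)%N by rewrite expn_gt0 prime_gt0 ?(pcharf_prime pcharS).
elim: n => [|n IHn]; first by rewrite /= expr0n eqn0Ngt D0 mulr0 add0r subr0 oner_eq0.
have -> : crit_orbit D c n.+2 - crit_orbit D c n.+1 =
    c * (crit_orbit D c n.+1 - crit_orbit D c n) ^+ D.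
  by rewrite expr_sub_pchar /=; ring.
by rewrite mulf_neq0 ?expf_neq0.
Qed.

End ReductionModP.

(** * The Eisenstein polynomial *)

Lemma irreducible_translate (S : idomainType) (c : S) (Q : {poly S}) :
  irreducible_poly (Q \Po ('X + c%:P)) -> irreducible_poly Q.
Proof.
have s2 : size ('X + c%:P) = 2 by rewrite size_XaddC.
case; rewrite size_comp_poly2 // => Q1 irrQ; split=> // q q1 dvq.
have /(irrQ _) : size (q \Po ('X + c%:P)) != 1%N by rewrite size_comp_poly2.
move=> /(_ (dvdp_comp_poly _ dvq)) /andP[_ /(dvdp_comp_poly ('X - c%:P))].
by rewrite !comp_polyXaddC_K /eqp dvq.
Qed.

(** Translating c to 0 turns this into the usual Eisenstein criterion: the lower
coefficients of the translate vanish modulo p, and its constant term is Q(c). *)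
Lemma eisenstein_at (p m : nat) (c : int) (Q : {poly int}) : prime p ->
  (1 < size Q)%N -> Q \is monic ->
  map_poly intr Q = ('X - c%:~R%:P) ^+ m :> {poly 'F_p} ->
  ~~ (p%:Z ^+ 2 %| Q.[c])%Z ->
  irreducible_poly Q.
Proof.
move=> p_prime Q1 monQ Qmodp Qc; apply: (@irreducible_translate _ c).
set T := Q \Po _.
have sT : size T = size Q by rewrite size_comp_poly2 ?size_XaddC.
have lT : lead_coef T = 1.
  by rewrite lead_coef_comp ?size_XaddC // lead_coefXaddC expr1n mulr1 (monicP monQ).
have Tmodp : map_poly intr T = 'X^m :> {poly 'F_p}.
  rewrite map_comp_poly Qmodp rmorphD /= map_polyX map_polyC /= rmorphXn /=.
  by rewrite comp_polyB comp_polyX comp_polyC addrK.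
have Dm : (size T).-1 = m.
  have := congr1 (fun P : {poly 'F_p} => size P) Tmodp.
  by rewrite /= size_polyXn size_map_poly_id0 ?lT ?rmorph1 ?oner_eq0 // => ->.
apply: (eisenstein_crit p_prime); rewrite ?sT ?lT.
- by rewrite neq_ltn Q1 orbT.
- by rewrite dvdz1 absz_nat -[X in _ == X]/1%N neq_ltn prime_gt1 ?orbT.
- by rewrite -horner_coef0 horner_comp !hornerE.
rewrite -sT Dm => i ltim; rewrite (dvdz_pcharf (pchar_Fp p_prime)).
by rewrite -coef_map Tmodp coefXn ltn_eqF.
Qed.

(** Describes Q modulo p from the equation B = A (a + 1)^r Q, with v the
reduction of A. *)
Lemma monic_factor_XsubC_exp (S : idomainType) (c : S) (u v w : {poly S}) n :
  u \is monic -> v != 0 -> v * ('X - c%:P) ^+ n = v * (w * u) ->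
  exists m, u = ('X - c%:P) ^+ m.
Proof.
move=> monu v0 /(mulfI v0) E.
have /dvdp_exp_XsubCP [m _] : u %| ('X - c%:P) ^+ n by rewrite E dvdp_mulIr.
by rewrite eqp_monic // ?monic_exp ?monicXsubC // => /eqP ->; exists m.
Qed.

(** Divisibility by a monic polynomial descends from Q[X] to Z[X]. *)
Lemma monic_dvdp_rat (Q A : {poly int}) : Q \is monic ->
  map_poly (intr : int -> rat) Q %| map_poly intr A -> exists h, A = h * Q.
Proof. by move=> monQ; rewrite dvdp_rat_int => /(Pdiv.IdomainMonic.dvdpP monQ). Qed.

(** The index n stands for k - 2.  The value at -1 of the left factor
is what later forbids Q to divide it. *)
Lemma orbit_factorization (p e j n : nat) :
  prime p -> (j < e)%N ->
  let D := (p ^ e)%N in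
  let P := crit_orbit D ('X : {poly int}) in
  exists Q : {poly int}, exists r : nat,
  [/\ Q \is monic, irreducible_poly (map_poly (intr : int -> rat) Q), Q.[-1] = p%:R,
   homog_cyclo p (p ^ j) (P n.+3) (P n.+1) =
     homog_cyclo p (p ^ j) (P n.+2) (P n.+1) * (('X + 1) ^+ r * Q) &
   (homog_cyclo p (p ^ j) (P n.+2) (P n.+1)).[-1] = 1].
Proof.
move=> p_prime lje D P; set q := (p ^ j)%N.
have p0 := prime_gt0 p_prime; have p1 := prime_gt1 p_prime.
have q0 : (0 < q)%N by rewrite expn_gt0 p0.
have D1 : (1 < D)%N by rewrite -(exp1n e) ltn_exp2r ?(leq_ltn_trans _ lje).
have D0 : (0 < D)%N := ltnW D1.
have qpD : (q * p %| D)%N by rewrite -expnSr dvdn_exp2l.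
have [C defB] := homog_cyclo_orbit_dvd (@polyX int) n.+1 qpD.
rewrite -/P in defB; set A := homog_cyclo p q (P n.+2) _ in defB *.
set B := homog_cyclo p q (P n.+3) _ in defB *.
have PN1 m : (P m).[-1] = (odd m)%:R.
  rewrite -[RHS](crit_orbitN1 _ _ D0) -[_.[_]]/(horner_eval (-1) _).
  by rewrite rmorph_crit_orbit /= /horner_eval hornerX.
have cycN1 x y : (homog_cyclo p q x y).[-1] = homog_cyclo p q x.[-1] y.[-1] :> int.
  by rewrite -[LHS]/(horner_eval (-1) _) rmorph_homog_cyclo.
have A1 : A.[-1] = 1.
  by rewrite cycN1 !PN1 /=; case: (odd n); rewrite /= ?homog_cyclo01 ?homog_cyclo10.
have monP m : P m.+1 \is monic by case: (crit_orbit_monic int m D0).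
have monA : A \is monic by apply: monic_homog_cyclo => //; apply: size_crit_orbit_mono.
have monB : B \is monic.
  by apply: monic_homog_cyclo => //; apply: size_crit_orbit_mono => //; lia.
have mont : 'X + 1 \is @monic int by rewrite monicXaddC.
(* For n even, P_(n+1) and P_(n+3) are already 1 at -1.  For n odd both are
   divisible by a + 1, with cofactors equal to 1 at -1. *)
have [r [x [y [xE x1 y1]]]] : exists r (x y : {poly int}),
   [/\ homog_cyclo p q (P n.+3) (P n.+1) = ('X + 1) ^+ r * homog_cyclo p q x y,
      x.[-1] = 1 & y.[-1] = 1].
  have [oddn|evn] := boolP (odd n); last first.
    exists 0%N, (P n.+3), (P n.+1); rewrite expr0 mul1r; split; rewrite //.
      by rewrite PN1 /= (negbTE evn).
    by rewrite PN1 /= (negbTE evn).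
  have [h Eh] := crit_orbit_even ('X : {poly int}) n./2 D1.
  have [h' Eh'] := crit_orbit_even ('X : {poly int}) n.+1./2 D1.
  exists (q * p.-1)%N, (1 + ('X + 1) * h'), (1 + ('X + 1) * h).
  have n2 : n./2.*2.+2 = n.+1 by lia.
  have n2' : n.+1./2.*2.+2 = n.+3 by lia.
  rewrite n2 in Eh; rewrite n2' in Eh'; rewrite /P Eh Eh' homog_cyclo_homogeneous exprM.
  by split=> //; rewrite !hornerE /= ?addNr ?subrr ?mul0r ?addr0.
set B' := homog_cyclo p q x y in xE.
have B'1 : B'.[-1] = p%:R by rewrite cycN1 x1 y1 homog_cyclo11.
have tE : 'X + 1 = 'X - (-1)%:P :> {poly int} by rewrite polyCN opprK.
have [||Q defC defB'] := @cancel_XsubC_exp int (-1) r A C B'.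
- by rewrite A1 oner_eq0.
- by rewrite -tE -xE -defB.
have BE : B = A * (('X + 1) ^+ r * Q) by rewrite defB defC tE.
have monQ : Q \is monic.
  by move: monB; rewrite BE monicMl // monicMl // monic_exp.
have Q1 : Q.[-1] = p%:R by rewrite -B'1 -defB' hornerM A1 mul1r.
exists Q, r; split=> //.
have pch : p \in [pchar {poly 'F_p}] by rewrite pchar_poly pchar_Fp.
have [m Qm] : exists m, map_poly intr Q = ('X - (-1)%:~R%:P) ^+ m :> {poly 'F_p}.
  pose u := crit_orbit D ('X : {poly 'F_p}) n.+2 - crit_orbit D 'X n.+1.
  have uD : u != 0 by apply: crit_orbit_sub_neq0 => //; rewrite polyX_eq0.
  have Pmodp i : map_poly intr (P i) = crit_orbit D ('X : {poly 'F_p}) i.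
    by rewrite [LHS]rmorph_crit_orbit /= map_polyX.
  have cycmodp i i' : crit_orbit D ('X : {poly 'F_p}) i != crit_orbit D 'X i' ->
      map_poly intr (homog_cyclo p q (P i) (P i')) =
      (crit_orbit D ('X : {poly 'F_p}) i - crit_orbit D 'X i') ^+ (q * p.-1).
    by move=> ne; rewrite [LHS]rmorph_homog_cyclo /= !Pmodp homog_cyclo_pchar.
  have Esub := crit_orbit_sub_pchar pch e 'X n.+1; rewrite -/D -/u in Esub.
  have vD : crit_orbit D ('X : {poly 'F_p}) n.+3 - crit_orbit D 'X n.+1 != 0.
    by rewrite Esub mulf_neq0 // expf_neq0 // monic_neq0 // monicXaddC.
  apply: (@monic_factor_XsubC_exp _ _ _ (u ^+ (q * p.-1)) (('X + 1) ^+ r)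
            (D ^ n.+1 * (q * p.-1))).
  - by rewrite monic_map.
  - by rewrite expf_neq0.
  have Amodp : map_poly intr A = u ^+ (q * p.-1) by apply: cycmodp; rewrite -subr_eq0.
  have Bmodp : map_poly intr B = u ^+ (q * p.-1) * ('X + 1) ^+ (D ^ n.+1 * (q * p.-1)).
    by rewrite [('X + 1) ^+ _]exprM -exprMn -Esub; apply: cycmodp; rewrite -subr_eq0.
  have := congr1 (map_poly (intr : int -> 'F_p)) BE.
  rewrite [in X in _ = X -> _]rmorphM /= Amodp Bmodp => E.
  rewrite mulrN1z polyCN opprK E [in LHS]rmorphM /= rmorphXn rmorphD rmorph1 /=.
  by rewrite map_polyX.
apply/irreducible_rat_int; apply: (eisenstein_at p_prime _ monQ Qm).
- rewrite ltnNge; apply/negP => /size1_polyC Qc; move: Q1 (monicP monQ).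
  rewrite Qc lead_coefC hornerC => -> /eqP; rewrite -[1]/(1%:R) eqr_nat => /eqP ep.
  by rewrite ep in p1.
- by rewrite Q1 pmulrn intz dvdzE abszX !absz_nat -{2}(expn1 p) dvdn_Pexp2l //.
Qed.

(** * Roots of the factors and Misiurewicz parameters *)

(** By homogeneity the left-hand side says that homog_cyclo vanishes at (w, 1),
with w = x / y.  Then w^(p^(j+1)) = 1, and the order of w is not a smaller power
of p, for otherwise the value at (w, 1) would be p, which is nonzero in
characteristic 0. *)
Lemma homog_cyclo_eq0 (K : numFieldType) (p j : nat) (x y : K) : prime p -> y != 0 ->
  homog_cyclo p (p ^ j) x y = 0 <->
  exists2 w : K, (p ^ j.+1).-primitive_root w & x = w * y.
Proof.
move=> p_prime y0; set q := (p ^ j)%N.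
have cycw w : (homog_cyclo p q (w * y) y == 0) = (homog_cyclo p q w 1 == 0).
  by rewrite -{2}[y]mulr1 mulrC homog_cyclo_homogeneous mulf_eq0
             !expf_eq0 (negbTE y0) !andbF.
have factor1 (w : K) : w ^+ (p ^ j.+1) - 1 = (w ^+ q - 1) * homog_cyclo p q w 1.
  by have := homog_cyclo_factor p q w 1; rewrite !expr1n expnSr.
split=> [/eqP|[w prim ->]].
  rewrite -[x](divfK y0) cycw; set w := x / y => /eqP cw; exists w => //.
  have d0 : (0 < p ^ j.+1)%N by rewrite expn_gt0 prime_gt0.
  have wd : w ^+ (p ^ j.+1) = 1 by apply/eqP; rewrite -subr_eq0 factor1 cw mulr0.
  have wq : w ^+ q != 1.
    apply/eqP => wq1; move: cw; rewrite /homog_cyclo (eq_bigr (fun=> 1)) => [|i _].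
      by rewrite sumr_const card_ord => /eqP; rewrite pnatr_eq0 -leqn0 leqNgt prime_gt0.
    by rewrite wq1 !expr1n mulr1.
  have [m prim] := prim_order_exists d0 wd.
  case/(dvdn_pfactor _ _ p_prime) => i lei Em; rewrite Em in prim.
  move: lei; rewrite leq_eqVlt => /predU1P [<- //|ltij].
  by case/eqP: wq; apply/eqP; rewrite -(prim_order_dvd prim) dvdn_exp2l.
apply/eqP; rewrite cycw; have wq : w ^+ q - 1 != 0.
  by rewrite subr_eq0 -(prim_order_dvd prim) dvdn_Pexp2l ?prime_gt1 // ltnn.
by rewrite -(mulrI_eq0 _ (mulfI wq)) -factor1 prim_expr_order ?subrr.
Qed.

Section PeriodicPoints.
Variables (T : eqType) (f : T -> T).

Lemma periodic_iter m z : (0 < m)%N -> iter m f z = z -> periodic f z.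
Proof.
move=> m0 /eqP fz.
have ex : exists i, (0 < i)%N && (iter i f z == z) by exists m; rewrite m0.
case: (ex_minnP ex) => i /andP [i0 /eqP fi] mini; exists i; split=> // i' i'0 fi'.
by apply: mini; rewrite i'0 fi' eqxx.
Qed.

Lemma periodic_image i z : periodic f z -> periodic f (iter i f z).
Proof.
by case=> m [m0 fz _]; apply: (periodic_iter m0); rewrite -iterD addnC iterD fz.
Qed.

(** A periodic point is an iterate of its own image, so a relation that holds
along the orbit of f z holds at z as well. *)
Lemma periodic_image2 z : periodic f z -> f (f (f z)) = f z -> f (f z) = z.
Proof.
case=> [[|m] [//= _ fz _]] f3; rewrite -iterS iterSr in fz.
by rewrite -{1}fz -!iterS !iterSr f3.
Qed.

End PeriodicPoints.

Lemma iter_unicritical (K : fieldType) D (a : K) n :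
  iter n (unicritical D a) 0 = crit_orbit D a n.
Proof. by elim: n => //= n ->. Qed.

(** With y = P_(n+1) nonzero, the two conditions on homog_cyclo say that
P_(n+3) = w y with w of order d and that P_(n+2) is not of this form.  Since
w^D = 1, the former gives P_(n+4) = P_(n+2); and were P_(n+2) fixed, it would
equal P_(n+3) = w y.  The preperiod is not smaller, because y periodic would
force P_(n+3) = y, whereas w is not 1.  Finally, y = 0 would make 0
periodic in the direct implication, and P_2 = P_(n+3) = 0 in the converse. *)
Lemma misiurewicz_parametersE (K : numFieldType) (p e j n : nat) (a : K) :
  prime p -> (j < e)%N ->
  let D := (p ^ e)%N in let P := crit_orbit D a in
  misiurewicz_parameters K D n.+2 2 (p ^ j.+1) a <->
  [/\ homog_cyclo p (p ^ j) (P n.+3) (P n.+1) = 0,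
      homog_cyclo p (p ^ j) (P n.+2) (P n.+1) != 0 & a + 1 != 0].
Proof.
move=> p_prime lje D P; set f := unicritical D a.
have p0 := prime_gt0 p_prime; have p1 := prime_gt1 p_prime.
have D0 : (0 < D)%N by rewrite expn_gt0 p0.
have d1 : (1 < p ^ j.+1)%N by rewrite -(exp1n j.+1) ltn_exp2r.
have iterP i : iter i f 0 = P i by apply: iter_unicritical.
have PS i : P i.+1 = a * P i ^+ D + 1 by [].
have P2 : P 2 = a + 1 by rewrite !PS expr0n eqn0Ngt D0 mulr0 add0r expr1n mulr1.
have rootD (w : K) : (p ^ j.+1).-primitive_root w -> forall y : K, (w * y) ^+ D = y ^+ D.
  move=> prim y; have /eqP wD : w ^+ D == 1 by rewrite -(prim_order_dvd prim) dvdn_exp2l.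
  by rewrite exprMn wD mul1r.
have iterPD i m : iter i f (P m) = P (i + m)%N by rewrite -iterP -iterD iterP.
rewrite /misiurewicz_parameters /preperiodic_with /periodic_with_period /mkset.
rewrite -/f addn2 !subn1 !PeanoNat.Nat.pred_succ !iterP.
split=> [[[[_ _ min2] prep] [w prim Pw]]|[B0 A0 a1]].
  have y0 : P n.+1 != 0.
    apply/eqP => y0; have /(prep 0%N) // : periodic f 0.
    by apply: (@periodic_iter _ _ n.+1); rewrite ?iterP.
  split; first by apply/(homog_cyclo_eq0 _ _ p_prime y0); exists w.
    apply/eqP => /(homog_cyclo_eq0 _ _ p_prime y0) [w' prim' Pw'].
    have P32 : P n.+3 = P n.+2 by rewrite PS Pw' rootD.
    by have := min2 1%N isT; rewrite iterPD => /(_ P32).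
  rewrite -P2; apply/eqP => P20; have /(prep 0%N) // : periodic f 0.
  by apply: (@periodic_iter _ _ 2); rewrite ?iterP.
have y0 : P n.+1 != 0.
  apply: contraNneq a1 => y0; rewrite -P2 -(_ : P n.+3 = P 2); last first.
    by rewrite !(PS n.+2) !(PS n.+1) y0.
  have := homog_cyclo_factor p (p ^ j) (P n.+3) (P n.+1).
  rewrite B0 mulr0 y0 expr0n -expnSr eqn0Ngt (ltnW d1) subr0 => /eqP.
  by rewrite expf_eq0 => /andP [].
have [w prim Pw] := (homog_cyclo_eq0 _ _ p_prime y0).1 B0.
have P42 : P n.+4 = P n.+2 by rewrite PS Pw rootD.
have w1 : w != 1.
  apply: contraTneq prim => ->; apply/negP => prim.
  have := prim_order_dvd prim 1; rewrite expr1n eqxx dvdn1 => /eqP E; by rewrite E in d1.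
split; last by exists w.
split.
  split; rewrite ?iterPD // => -[|[|m]] // _; rewrite iterPD => E.
  case/eqP: A0; apply/(homog_cyclo_eq0 _ _ p_prime y0); exists w => //.
  by rewrite -Pw.
move=> i peri; rewrite leqNgt; apply/negP => lti; case/eqP: w1.
have /periodic_image2 : periodic f (P n.+1).
  by rewrite -iterP -(@subnK i n.+1) // iterD; apply: periodic_image.
rewrite -![f _]/(iter 1 f _) !iterPD => /(_ P42).
by rewrite [P _]Pw -{2}[P n.+1]mul1r => /(mulIf y0).
Qed.

Theorem misiurewicz_irreducible (K : numClosedFieldType) (p e j n : nat) :
  prime p -> (j < e)%N ->
  irreducible_over_rat (misiurewicz_poly K (p ^ e) n.+2 2 (p ^ j.+1)).
Proof.
move=> p_prime lje.
have [Q [r [monQ irrQ Q1 BE A1]]] := orbit_factorization n p_prime lje.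
set D := (p ^ e)%N in BE A1 *; set q := (p ^ j)%N in BE A1.
set A := homog_cyclo p q (crit_orbit D 'X n.+2) (crit_orbit D 'X n.+1) in BE A1.
set B := homog_cyclo p q _ _ in BE.
pose toK := map_poly (intr : int -> K); pose toQ := map_poly (intr : int -> rat).
have toKE P : toK P = map_poly ratr (toQ P).
  by rewrite /toK /toQ -map_poly_comp; apply: eq_map_poly => z /=; rewrite ratr_int.
(* In characteristic 0 the derivative is nonzero of smaller degree, hence
   prime to the irreducible Q. *)
have sepQ : separable_poly (toK Q).
  rewrite toKE separable_map unlock irreducible_poly_coprime //.
  apply/negP => /dvdp_leq; have s1 := irrQ.1.
  rewrite -size_poly_gt0 polyorder.size_deriv.
  case: (size _) s1 => [|[|s]] //= _ /(_ isT).
  by rewrite ltnn.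
have [rs] := closed_field_poly_normal (toK Q).
rewrite (monicP _) ?monic_map // scale1r => Ers.
have urs : uniq rs by rewrite -separable_prod_XsubC -Ers.
(* Otherwise Q divides A, and evaluation at -1 gives that p divides 1. *)
have coAQ : coprimep (toK Q) (toK A).
  rewrite !toKE coprimep_map irreducible_poly_coprime //.
  apply/negP => /(monic_dvdp_rat monQ) [h Ah].
  move: A1; rewrite Ah hornerM Q1 => /(congr1 absz).
  rewrite abszM pmulrn intz absz_nat /= => E.
  have := dvdn_mull `|h.[-1]| (dvdnn p); rewrite E dvdn1 => /eqP p1.
  by rewrite p1 in p_prime.
have evP a i : (toK (crit_orbit D 'X i)).[a] = crit_orbit D a i.
  rewrite -[LHS]/(horner_eval a (map_poly intr _)) !rmorph_crit_orbit /=.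
  by rewrite map_polyX /horner_eval hornerX.
have evcyc a x y :
    (toK (homog_cyclo p q x y)).[a] = homog_cyclo p q (toK x).[a] (toK y).[a].
  by rewrite -[LHS]/(horner_eval a (map_poly intr _)) !rmorph_homog_cyclo.
have rsE : misiurewicz_parameters K D n.+2 2 (p ^ j.+1) = [set` rs]%classic.
  have memrs a : (a \in rs) = ((toK Q).[a] == 0) by rewrite -root_prod_XsubC -Ers.
  have evBE a : homog_cyclo p q (crit_orbit D a n.+3) (crit_orbit D a n.+1) =
      (toK A).[a] * ((a + 1) ^+ r * (toK Q).[a]).
    rewrite -!evP -evcyc -/B BE /toK !rmorphM rmorphXn rmorphD rmorph1 /=.
    by rewrite map_polyX !hornerE.
  have evA a : (toK A).[a] = homog_cyclo p q (crit_orbit D a n.+2) (crit_orbit D a n.+1).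
    by rewrite evcyc !evP.
  apply/seteqP; split=> a; rewrite /= memrs.
    case/(misiurewicz_parametersE n a p_prime lje) => B0 A0 a1; move: B0.
    by rewrite evBE => /eqP; rewrite !mulf_eq0 expf_eq0 (negbTE a1) evA (negbTE A0) andbF.
  move=> Qa; apply/(misiurewicz_parametersE n a p_prime lje); split.
  - by rewrite evBE (eqP Qa) !mulr0.
  - by rewrite -evA (coprimep_root coAQ).
  - apply: contraTneq Qa => /eqP; rewrite addr_eq0 => /eqP ->.
    have -> : -1 = (-1)%:~R :> K by rewrite rmorphN1.
    by rewrite horner_map /= Q1 rmorph_nat pnatr_eq0 -lt0n prime_gt0.
exists (toQ Q) => //; rewrite -toKE Ers /misiurewicz_poly rsE.
by rewrite fsbig_seq.
Qed.

Theorem corollary19 (R : realType) (p e D : nat)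
    (p_prime : prime p) (e_ge1 : (1 <= e)%N) (D_def : D = (p ^ e)%N)
    (k d : nat) (k_ge2 : (2 <= k)%N) (d_ge2 : (2 <= d)%N) (d_dvd_D : (d %| D)%N) :
  irreducible_over_rat (misiurewicz_poly R[i] D k 2 d).
Proof.
subst D; have [j lej Ed] := dvdn_pfactor _ _ p_prime d_dvd_D; subst d.
case: j lej d_ge2 {d_dvd_D} => [|j] lej d_ge2; first by rewrite expn0 in d_ge2.
by case: k k_ge2 => [|[|n]] // _; apply: misiurewicz_irreducible.
Qed.
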